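(* For every integer $t\geq 4$, every graph $G$ that does not contain $K_t$ as a minor has a connected partition $H_1,\dots,H_\ell$ such that: (1) the quotient graph $Q$ obtained from $G$ by contracting each $H_i$ to a single vertex is chordal with clique number at most $t-1$ (and hence has treewidth at most $t-2$); and (2) each $H_i$ has bandwidth (and hence pathwidth and treewidth) at most $t-3$.
   Context: All graphs are finite and simple. A sequence $H_1,\dots,H_\ell$ is a connected partition of $G$ if each $H_i$ is a non-empty connected induced subgraph of $G$, the $H_i$ are pairwise vertex-disjoint, and $V(G)=V(H_1)\cup\dots\cup V(H_\ell)$. A graph $H$ has bandwidth at most $k$ if there is an ordering $v_1,\dots,v_n$ of $V(H)$ with $|i-j|\leq k$ for every edge $v_iv_j$. *)

(* Defs.v *)
From mathcomp Require Import all_boot.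

Set Implicit Arguments.
Unset Strict Implicit.
Unset Printing Implicit Defensive.

Record sgraph := SGraph {
  vertex :> finType;
  adj : rel vertex;
  adj_sym : symmetric adj;
  adj_irr : irreflexive adj }.

Section InducedSubgraph.
Variables (G : sgraph) (A : {set G}).

Definition induced_adj : rel {x : G | x \in A} :=
  fun u v => adj (val u) (val v).

Lemma induced_adj_sym : symmetric induced_adj.
Proof. by move=> u v; apply: adj_sym. Qed.

Lemma induced_adj_irr : irreflexive induced_adj.
Proof. by move=> u; apply: adj_irr. Qed.

Definition induced : sgraph := SGraph induced_adj_sym induced_adj_irr.
End InducedSubgraph.

Section CompleteGraph.
Variable n : nat.

Definition complete_adj : rel 'I_n := fun i j => i != j.

Lemma complete_adj_sym : symmetric complete_adj.
Proof. by move=> i j; rewrite /complete_adj eq_sym. Qed.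

Lemma complete_adj_irr : irreflexive complete_adj.
Proof. by move=> i; rewrite /complete_adj eqxx. Qed.

Definition complete_graph : sgraph := SGraph complete_adj_sym complete_adj_irr.
End CompleteGraph.

Section PathGraph.
Variable n : nat.

Definition path_adj : rel 'I_n := fun i j => (i.+1 == j) || (j.+1 == i).

Lemma path_adj_sym : symmetric path_adj.
Proof. by move=> i j; rewrite /path_adj orbC. Qed.

Lemma path_adj_irr : irreflexive path_adj.
Proof. by move=> i; rewrite /path_adj orbb gtn_eqF. Qed.

Definition path_graph : sgraph := SGraph path_adj_sym path_adj_irr.
End PathGraph.

(* The graph without vertices is connected in this sense; non-emptiness is
   required separately wherever it is meant. *)
Definition connected (G : sgraph) : Prop :=
  forall x y : G, connect (@adj G) x y.

(* H is a minor of G, by branch sets: contracting each B x, and deleting the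
   other vertices and the superfluous edges, turns G into H. *)
Definition minor (H G : sgraph) : Prop :=
  exists B : H -> {set G},
    [/\ forall x : H, B x != set0 /\ connected (induced (B x)),
        forall x y : H, x != y -> [disjoint B x & B y] &
        forall x y : H, adj x y ->
          exists u v : G, [/\ u \in B x, v \in B y & adj u v]].

(* The induced subgraphs H_0, ..., H_(l-1) are given by their vertex sets. *)
Definition connected_partition (G : sgraph) (l : nat) (H : 'I_l -> {set G}) :
    Prop :=
  [/\ forall i : 'I_l, H i != set0 /\ connected (induced (H i)),
      forall i j : 'I_l, i != j -> [disjoint H i & H j] &
      \bigcup_(i < l) H i = [set: G]].

Section Quotient.
Variables (G : sgraph) (l : nat) (H : 'I_l -> {set G}).

Definition quotient_adj : rel 'I_l := fun i j =>
  (i != j) && [exists u in H i, exists v in H j, adj u v].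

Lemma quotient_adj_sym : symmetric quotient_adj.
Proof.
move=> i j; rewrite /quotient_adj eq_sym; congr (_ && _).
by apply/exists_inP/exists_inP => -[u Hu /exists_inP[v Hv uv]];
  exists v => //; apply/exists_inP; exists u; rewrite // adj_sym.
Qed.

Lemma quotient_adj_irr : irreflexive quotient_adj.
Proof. by move=> i; rewrite /quotient_adj eqxx. Qed.

Definition quotient_graph : sgraph := SGraph quotient_adj_sym quotient_adj_irr.
End Quotient.

(* Every cycle of length at least 4 has a chord, i.e. an edge between two of
   its vertices that are not consecutive on it. *)
Definition chordal (G : sgraph) : Prop :=
  forall c : seq G, ucycle (@adj G) c -> 4 <= size c ->
    exists x y : G,
      [/\ x \in c, y \in c, adj x y, y != next c x & x != next c y].

Definition clique (G : sgraph) (K : {set G}) : bool :=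
  [forall x in K, forall y in K, (x != y) ==> adj x y].

Definition clique_number (G : sgraph) : nat :=
  \max_(K : {set G} | clique K) #|K|.

(* ucycle also accepts walks x, y, x along a single edge as cycles of length 2,
   hence the lower bound on the length. *)
Definition tree (T : sgraph) : Prop :=
  [/\ 0 < #|T|, connected T &
      forall c : seq T, ucycle (@adj T) c -> size c < 3].

Definition decomposition (G T : sgraph) (B : T -> {set G}) : Prop :=
  [/\ forall v : G, exists t : T, v \in B t,
      forall u v : G, adj u v -> exists t : T, (u \in B t) && (v \in B t) &
      forall v : G, connected (induced [set t | v \in B t])].

Definition width_at_most (G T : sgraph) (B : T -> {set G}) (k : nat) : Prop :=
  forall t : T, #|B t| <= k.+1.

Definition treewidth_at_most (G : sgraph) (k : nat) : Prop :=
  exists (T : sgraph) (B : T -> {set G}),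
    [/\ tree T, decomposition B & width_at_most B k].

Definition pathwidth_at_most (G : sgraph) (k : nat) : Prop :=
  exists (n : nat) (B : path_graph n.+1 -> {set G}),
    decomposition B /\ width_at_most B k.

(* The ordering is the bijection f, with positions numbered from 0; the two
   inequalities say that |f x - f y| <= k. *)
Definition bandwidth_at_most (G : sgraph) (k : nat) : Prop :=
  exists f : G -> 'I_#|G|, bijective f /\
    forall x y : G, adj x y -> f x <= f y + k /\ f y <= f x + k.

(* Main.v *)
Require Import Defs.
From mathcomp Require Import all_boot zify.

Set Implicit Arguments.
Unset Strict Implicit.
Unset Printing Implicit Defensive.

(* The parts are chosen one after the other, so that the parts touching any
   connected set of uncovered vertices touch each other. Given a component C of
   the uncovered vertices, the parts touching C together with C form a clique
   minor, so there are at most t - 2 of them. The next part is a minimal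
   connected subset A of C that contains a set U of at most t - 2 vertices with
   a neighbour in each of those parts. Hence every part and the earlier parts
   touching it form a clique, i.e. the quotient has a perfect elimination
   ordering, which gives chordality, the clique number and the treewidth.
   A breadth-first ordering of A witnesses its bandwidth: by minimality the
   leaves of the breadth-first tree lie in U, and every edge of A spans at most
   as many positions as there are leaves other than the root. *)

(** * Connected vertex sets and contact between them *)

Section ConnectedSets.
Variable G : sgraph.
Implicit Types (A B C U : {set G}) (s : seq G).

Definition adj_in A : rel G := fun x y => [&& x \in A, y \in A & adj x y].

(** A boolean form of connectedness, on subsets of [G] itself, so that minimal and maximal connected
    sets can be taken with [minset] and [maxset]. *)
Definition conn A : bool :=
  [forall x in A, forall y in A, connect (adj_in A) x y].

Definition touch A B : bool := [exists u in A, exists v in B, adj u v].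

Lemma adj_in_sym A : symmetric (adj_in A).
Proof. by move=> x y; rewrite /adj_in adj_sym andbCA. Qed.

Lemma connect_adj_in_sym A : connect_sym (adj_in A).
Proof. exact/sym_connect_sym/adj_in_sym. Qed.

Lemma connP A :
  reflect {in A &, forall x y, connect (adj_in A) x y} (conn A).
Proof.
apply: (iffP forall_inP) => [cA x y Ax Ay | cA x Ax].
  by move/forall_inP: (cA x Ax); apply.
by apply/forall_inP => y Ay; apply: cA.
Qed.

Lemma conn_from x A :
  (forall y, y \in A -> connect (adj_in A) x y) -> conn A.
Proof.
move=> cx; apply/connP => y z Ay Az.
by apply: connect_trans (cx z Az); rewrite connect_adj_in_sym cx.
Qed.

Lemma connected_induced A : conn A <-> connected (induced A).
Proof.
split=> [/connP cA u v | cA].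
  have /connectP[p] := cA _ _ (valP u) (valP v).
  elim: p u => [|y p IHp] u /= => [_ /val_inj -> // |].
  case/andP=> /and3P[_ Ay uy] py lastv.
  exact: (connect_trans (connect1 (uy : adj u (Sub y Ay : induced A)))
            (IHp (Sub y Ay) py lastv)).
apply/connP => x y Ax Ay.
have /connectP[p] := cA (Sub x Ax) (Sub y Ay).
rewrite -[x in connect _ x]/(val (Sub x Ax : induced A)).
elim: p (Sub x Ax) => [|z p IHp] u /=; first by move=> _ <-.
case/andP=> uz pz lasty; apply: connect_trans (IHp z pz lasty).
by apply: connect1; rewrite /adj_in !(valP (_ : induced A)).
Qed.

Lemma conn1 x : conn [set x].
Proof. by apply: (@conn_from x) => y /set1P ->. Qed.

Lemma touchP A B :
  reflect (exists u v, [/\ u \in A, v \in B & adj u v]) (touch A B).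
Proof.
apply: (iffP exists_inP) => [[u Au /exists_inP[v Bv uv]] | [u [v [Au Bv uv]]]].
  by exists u, v.
by exists u => //; apply/exists_inP; exists v.
Qed.

Lemma touch_sym A B : touch A B = touch B A.
Proof.
by apply/touchP/touchP => -[u [v [? ? ?]]]; exists v, u; rewrite adj_sym.
Qed.

Lemma touchS A A' B : A \subset A' -> touch A B -> touch A' B.
Proof.
move=> /subsetP sAA' /touchP[u [v [Au Bv uv]]].
by apply/touchP; exists u, v; rewrite sAA'.
Qed.

Lemma adj_inS A B :
  A \subset B -> subrel (connect (adj_in A)) (connect (adj_in B)).
Proof.
move=> /subsetP sAB; apply: connect_sub => x y /and3P[Ax Ay xy].
by apply: connect1; rewrite /adj_in !sAB.
Qed.

Lemma connU A B : conn A -> conn B -> touch A B -> conn (A :|: B).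
Proof.
move=> /connP cA /connP cB /touchP[u [v [Au Bv uv]]].
apply: (@conn_from u) => y /setUP[Ay | By].
  exact: adj_inS (subsetUl A B) _ _ (cA u y Au Ay).
apply: connect_trans (adj_inS (subsetUr A B) (cB v y Bv By)).
by apply: connect1; rewrite /adj_in !inE Au Bv uv orbT.
Qed.

(** * Breadth-first orderings of a connected set *)

Lemma conn_exit A s x0 : conn A -> x0 \in A -> x0 \in s ->
  ~~ (A \subset s) -> exists2 x, x \in A & (x \notin s) && has (adj x) s.
Proof.
move=> /connP cA Ax0 sx0 /subsetPn[y Ay nsy].
have /connectP[p] := cA _ _ Ax0 Ay.
elim: p x0 {Ax0} sx0 => [|z p IHp] x sx /=.
  by move=> _ yx; rewrite yx sx in nsy.
case/andP=> /and3P[_ Az xz] pz lasty.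
case sz: (z \in s); first exact: (IHp z sz pz lasty).
by exists z; rewrite // sz /=; apply/hasP; exists x; rewrite // adj_sym.
Qed.

(* The parent of x in the breadth-first tree is its first neighbour in s, at
   position find (adj x) s. *)
Definition bfs x0 A s :=
  [/\ uniq s, {subset s <= A}, index x0 s = 0 /\ x0 \in s,
      forall x, x \in s -> x != x0 -> find (adj x) s < index x s &
      forall x y, x \in s -> x != x0 -> y \in A -> index x s <= index y s ->
        find (adj x) s <= find (adj y) s].

(** The vertex to append is one outside [s] whose first neighbour in [s] comes earliest. The order
    is preserved because the last clause of [bfs] also covers unlisted vertices of [A], whose index
    is [size s]: none of them has its first neighbour before that of a listed non-root vertex. *)
Lemma bfs_rcons x0 A s : conn A -> x0 \in A -> bfs x0 A s ->
  ~~ (A \subset s) -> exists x, bfs x0 A (rcons s x).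
Proof.
move=> cA Ax0 [us sA [ix0 sx0] lt_p mono] nAs.
have [z Az zP] := conn_exit cA Ax0 sx0 nAs.
have Pz : [pred x | (x \in A) && (x \notin s)] z.
  by rewrite /= Az; case/andP: zP.
case: (arg_minnP (fun x => find (adj x) s) Pz) => x /= /andP[Ax nsx] minx.
have hx : find (adj x) s < size s.
  apply: leq_ltn_trans (minx z _) _; first exact: Pz.
  by rewrite -has_find; case/andP: zP.
have sz_rc : size (rcons s x) = (size s).+1 by rewrite size_rcons.
have fE y : find (adj y) s < size s ->
    find (adj y) (rcons s x) = find (adj y) s.
  by rewrite -has_find -cats1 find_cat => ->.
(* A vertex without neighbour in [s] has the default value [size s], which appending [x] does not
   decrease. *)
have fge y : find (adj y) s <= find (adj y) (rcons s x).
  rewrite -cats1 find_cat; case: ifP => // /negbT nh.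
  by rewrite hasNfind // leq_addr.
have iE y : y \in s -> index y (rcons s x) = index y s.
  by move=> sy; rewrite -cats1 index_cat sy.
have ix : index x (rcons s x) = size s.
  by rewrite -cats1 index_cat (negbTE nsx) /= eqxx addn0.
have fs y : y \in s -> y != x0 -> find (adj y) s < size s.
  move=> sy yx0; apply: ltn_trans (lt_p y sy yx0) _.
  by rewrite index_mem.
exists x; split.
- by rewrite rcons_uniq nsx us.
- by move=> y; rewrite mem_rcons inE => /predU1P[-> | /sA].
- by rewrite iE // mem_rcons inE sx0 orbT.
- move=> y; rewrite mem_rcons inE => /predU1P[-> _ | sy yx0].
    by rewrite ix fE.
  by rewrite fE ?fs // iE // lt_p.
move=> y w; rewrite mem_rcons inE => /predU1P[-> _ | sy yx0] Aw.
  rewrite ix fE // => le_w.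
  case sw: (w \in s); first by move: le_w; rewrite iE // leqNgt index_mem sw.
  by apply: leq_trans (fge w); apply: minx; rewrite Aw sw.
rewrite iE // fE ?fs // => le_w; apply: leq_trans (fge w).
case sw: (w \in s); first by apply: mono => //; rewrite -(iE w).
by apply: mono => //; rewrite (memNindex (negbT sw)) index_size.
Qed.

Lemma bfs_exists x0 A : conn A -> x0 \in A ->
  exists s, bfs x0 A s /\ s =i A.
Proof.
move=> cA Ax0.
(* After [#|A|] extensions the list covers [A] or has at least [#|A|] distinct entries from [A];
   either way it enumerates [A]. *)
have [s bs sz] : exists2 s, bfs x0 A s & (A \subset s) || (#|A| <= size s).
  elim: #|A| => [|n [s bs le_s]].
    exists [:: x0]; last by rewrite orbT.
    split=> //= [|||x y].
    - by move=> y; rewrite inE => /eqP ->.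
    - by rewrite eqxx inE.
    - by move=> x; rewrite inE => /eqP ->; rewrite eqxx.
    by rewrite inE => /eqP ->; rewrite eqxx.
  case sAs: (A \subset s) le_s => /= le_s; first by exists s; rewrite ?sAs.
  have [x bx] := bfs_rcons cA Ax0 bs (negbT sAs).
  by exists (rcons s x); rewrite ?size_rcons ?ltnS ?le_s ?orbT.
exists s; split=> // x; case: (bs) => us sA _ _ _.
case/orP: sz => [/subsetP As | le_s].
  by apply/idP/idP; [apply: sA | apply: As].
have sub : {subset s <= enum A} by move=> y sy; rewrite mem_enum sA.
by have [|_ ->] := uniq_min_size us sub; rewrite ?mem_enum -?cardE.
Qed.

(* Let p be the position of the parent of b. As parents occur in the order of
   their children, the inner vertices after p are parents of vertices after b.
   So at least (index b s - p) of the vertices after p are leaves; these lie in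
   U, since deleting a leaf keeps A connected, and they are not the root. *)
Lemma bfs_bandwidth x0 A U s :
  minset (fun B => conn B && (U \subset B)) A -> x0 \in U ->
  bfs x0 A s -> s =i A ->
  forall a b, a \in A -> b \in A -> adj a b -> index b s <= index a s + #|U|.-1.
Proof.
move=> /minsetP[/andP[cA UA] minA] Ux0 [us sA [ix0 sx0] lt_p mono] sE.
move=> a b Aa Ab ab.
have [-> | bx0] := eqVneq b x0; first by rewrite ix0.
have sb : b \in s by rewrite sE.
(* Since [a] is a neighbour of [b], the parent of [b] does not come after [a]; it suffices to bound
   the distance from [b] to its parent. *)
have pa : find (adj b) s <= index a s.
  rewrite leqNgt; apply/negP => lt_a.
  have := before_find x0 lt_a.
  by rewrite nth_index ?sE // adj_sym ab.
apply: leq_trans (_ : find (adj b) s + #|U|.-1 <= _); last by rewrite leq_add2r.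
pose par x := nth x0 s (find (adj x) s).
have ipar x : x \in s -> x != x0 -> index (par x) s = find (adj x) s.
  move=> sx xx0; apply: index_uniq => //.
  by apply: ltn_trans (lt_p x sx xx0) _; rewrite index_mem.
have spar x : x \in s -> x != x0 -> par x \in s.
  move=> sx xx0; apply: mem_nth.
  by apply: ltn_trans (lt_p x sx xx0) _; rewrite index_mem.
have apar x : x \in s -> x != x0 -> adj x (par x).
  move=> sx xx0; apply: nth_find.
  by rewrite has_find; apply: ltn_trans (lt_p x sx xx0) _; rewrite index_mem.
pose internal w := has (fun c => (c != x0) && (par c == w)) s.
pose D := drop (find (adj b) s).+1 s.
pose E := drop (index b s).+1 s.
have dropE y n : y \in s -> (y \in drop n s) = (n <= index y s).
  move=> sy; rewrite -{1}(cat_take_drop n s) in us.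
  move: us; rewrite cat_uniq => /and3P[_ /hasPn disj _].
  have := sy; rewrite -{1}(cat_take_drop n s) mem_cat in_take // => sy'.
  case: leqP sy' => //= lt_n _.
  by apply/negbTE/negP => /disj; rewrite in_take // lt_n.
have uD : uniq D by apply: drop_uniq.
have sD y : y \in D -> y \in s by apply: mem_drop.
(* A child at or before [b] has its parent at or before the parent of [b], by monotonicity, so all
   children of vertices in [D] lie in [E]. *)
have le_int : count internal D <= size E.
  rewrite -size_filter -(size_map par E); apply: uniq_leq_size.
    exact: filter_uniq.
  move=> w; rewrite mem_filter => /andP[/hasP[c sc /andP[cx0 /eqP <-]] Dw].
  apply: map_f; rewrite dropE // ltnNge; apply/negP => le_cb.
  have := mono _ _ sc cx0 Ab le_cb.
  by move: Dw; rewrite dropE ?spar // ipar // ltnNge => /negP.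
have le_leaf : count (predC internal) D <= #|U|.-1.
  rewrite -size_filter.
  have -> : #|U|.-1 = size (enum (U :\ x0)) by rewrite -cardE (cardsD1 x0) Ux0.
  apply: uniq_leq_size; first exact: filter_uniq.
  move=> w; rewrite mem_filter mem_enum !inE => /andP[/= nint Dw].
  have sw := sD w Dw.
  have wx0 : w != x0.
    by apply/eqP => wE; move: Dw; rewrite wE dropE // ix0.
  rewrite wx0 /=; apply/negPn/negP => nUw.
  (* The chain of parents from any other vertex to the root avoids [w], which is nobody's parent;
     hence the induction on the position. *)
  have cw : conn (A :\ w).
    apply: (@conn_from x0) => y; move: {2}(index y s) (leqnn (index y s)) => n.
    elim: n y => [|n IHn] y le_y.
      rewrite !inE -sE => /andP[yw sy].
      suff -> : y = x0 by [].
      move: le_y; rewrite leqn0 => /eqP iy.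
      by rewrite -[LHS](nth_index x0 sy) iy -ix0 nth_index.
    have [-> // | yx0] := eqVneq y x0.
    rewrite !inE -sE => /andP[yw sy].
    have pw : par y != w.
      by apply: contra nint => pw; apply/hasP; exists y; rewrite // yx0.
    have Apw : par y \in A :\ w by rewrite !inE pw -sE spar.
    apply: connect_trans (IHn (par y) _ Apw) _.
      by rewrite ipar // -ltnS; apply: leq_trans (lt_p y sy yx0) le_y.
    by apply: connect1; rewrite /adj_in Apw !inE yw -sE sy adj_sym apar.
  have := minA (A :\ w).
  rewrite cw subsetD1 UA nUw => /(_ isT (subsetDl _ _)) AE.
  by move: sw; rewrite sE -AE !inE eqxx.
(* Writing p for the position of the parent of [b], the lists [D] and [E] have [size s] - p - 1 and
   [size s - index b s] - 1 entries, so [index b s] - p is at most the number of leaves in [D]. *)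
have := count_predC internal D; rewrite size_drop.
move: le_int; rewrite size_drop.
have : index b s < size s by rewrite index_mem.
have := lt_p b sb bx0.
move: le_leaf; clear;
  move: (count _ D) (count _ D) (#|U|.-1) (find _ _) (index _ _) (size s).
  move=> i j k f n m.
lia.
Qed.

End ConnectedSets.

(** * Cycles and trees through a rank function *)

(** Puts a chosen vertex of a cycle, later the one of largest rank, in second place, so that both
    its neighbours on the cycle become explicit. *)
Lemma rot_before (T : eqType) (c : seq T) (x : T) :
  uniq c -> x \in c -> 2 < size c ->
  exists i w y q, rot i c = [:: w, x, y & q].
Proof.
move=> uc cx lt_c; have cw : prev c x \in c by rewrite mem_prev.
have [i p rc] := rot_to cw.
have := next_prev uc x; rewrite -(next_rot i uc) rc.
have : size (rot i c) = size c by rewrite size_rot.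
case: p rc => [|z [|y q]] rc; rewrite ?rc /=; try lia.
by rewrite eqxx => _ zx; exists i, (prev c x), y, q; rewrite rc zx.
Qed.

Lemma arg_max_seq (T : eqType) (r : T -> nat) (c : seq T) :
  0 < size c -> exists2 x, x \in c & {in c, forall y, r y <= r x}.
Proof.
elim: c => //= a [|b c] IHc _.
  by exists a; rewrite ?mem_head // => y; rewrite inE => /eqP ->.
have [x cx maxx] := IHc isT.
case: (leqP (r a) (r x)) => [le_ax | lt_xa].
  by exists x => [|y]; rewrite inE ?cx ?orbT // => /predU1P[-> | /maxx].
exists a => [|y]; first exact: mem_head.
by rewrite inE => /predU1P[-> | /maxx le_yx]; lia.
Qed.

(** Descending in rank leads from every vertex to [x0]. On a cycle of length at least 3, a vertex of
    largest rank would have two distinct neighbours of no larger rank. *)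
Lemma tree_of_rank (T : sgraph) (r : T -> nat) (x0 : T) :
  (forall x, x != x0 -> exists2 y, adj x y & r y < r x) ->
  (forall x y z, adj x y -> adj x z -> r y <= r x -> r z <= r x -> y = z) ->
  tree T.
Proof.
move=> down unique; split; first by apply/card_gt0P; exists x0.
- have to_x0 x : connect (@adj T) x x0.
    have [n] := ubnP (r x); elim: n x => // n IHn x le_n.
    have [-> // | /down[y xy lt_yx]] := eqVneq x x0.
    by apply: connect_trans (connect1 xy) (IHn y _); lia.
  move=> x y; apply: connect_trans (to_x0 x) _.
  by rewrite (sym_connect_sym (@adj_sym T)).
move=> c /andP[cc uc]; rewrite leqNgt; apply/negP => lt_c.
have [x cx maxx] := arg_max_seq r (ltnW (ltnW lt_c)).
have [i [w [y [q rc]]]] := rot_before uc cx lt_c.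
have mem z : z \in rot i c -> r z <= r x by rewrite mem_rot; apply: maxx.
move: cc uc; rewrite -(rot_cycle i) -(rot_uniq i) rc /=.
case/and3P=> wx xy _ /andP[nw _].
have wy : w = y.
  by apply: unique (mem w _) (mem y _); rewrite ?rc ?inE ?eqxx ?orbT // adj_sym.
by rewrite wy !inE eqxx orbT in nw.
Qed.

(** * Perfect elimination orderings: chordality, clique number and treewidth *)

Section EliminationOrder.
Variables (G : sgraph) (r : G -> nat) (k : nat).

Definition earlier (x : G) : {set G} := [set y | adj x y & r y < r x].

Hypothesis r_inj : injective r.
Hypothesis clique_earlier : forall x, clique (earlier x).
Hypothesis card_earlier : forall x, #|earlier x| <= k.

Lemma earlier_adj x y z :
  y \in earlier x -> z \in earlier x -> y != z -> adj y z.
Proof.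
move=> xy xz yz.
have /forall_inP/(_ y xy)/forall_inP/(_ z xz) := clique_earlier x.
by rewrite yz.
Qed.

Lemma adj_earlier x y : adj x y -> r y <= r x -> y \in earlier x.
Proof.
move=> xy; rewrite inE xy leq_eqVlt => /predU1P[/r_inj yx | //].
by rewrite yx adj_irr in xy.
Qed.

(** The two neighbours on the cycle of its last vertex are both earlier than it, hence adjacent. *)
Lemma chordal_earlier : chordal G.
Proof.
move=> c /andP[cc uc] lt_c.
have [x cx maxx] := arg_max_seq r (ltnW (ltnW (ltnW lt_c))).
have [i [w [y [q rc]]]] := rot_before uc cx (ltnW lt_c).
have mem z : z \in rot i c -> r z <= r x by rewrite mem_rot; apply: maxx.
have memc z : (z \in c) = (z \in [:: w, x, y & q]) by rewrite -rc mem_rot.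
have nE z : next c z = next [:: w, x, y & q] z by rewrite -rc next_rot.
have : 4 <= size (rot i c) by rewrite size_rot.
move: cc uc; rewrite -(rot_cycle i) -(rot_uniq i) rc /=.
(* The fourth vertex [z] keeps [w] and [y] from being consecutive on the cycle. *)
case: q rc memc nE => [|z q] // rc memc nE.
case/and3P=> wx xy _ /andP[nw /andP[nx _]] _.
have ew : w \in earlier x.
  by rewrite adj_earlier 1?adj_sym // mem // rc inE eqxx.
have ey : y \in earlier x.
  by rewrite adj_earlier // mem // rc !inE eqxx !orbT.
move: nw nx; rewrite !inE !negb_or => /and4P[n_wx n_wy n_wz _] /and3P[n_xy _ _].
have yw : (y == w) = false by rewrite eq_sym (negbTE n_wy).
have yx : (y == x) = false by rewrite eq_sym (negbTE n_xy).
exists w, y; split; rewrite ?memc ?inE ?eqxx ?orbT ?nE /= ?eqxx ?yw ?yx //.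
exact: earlier_adj ew ey n_wy.
Qed.

(** All vertices of a clique but its last one [x] lie in [earlier x]. *)
Lemma clique_number_earlier : clique_number G <= k.+1.
Proof.
apply/bigmax_leqP => K cK.
have [-> | /set0Pn[x0 Kx0]] := eqVneq K set0; first by rewrite cards0.
case: (arg_maxnP r Kx0) => x Kx maxx.
rewrite (cardsD1 x) (Kx : x \in K) ltnS; apply: leq_trans (card_earlier x).
apply/subset_leq_card/subsetP => y; rewrite !inE => /andP[yx Ky].
apply: etrans (_ : y \in earlier x = true); first by rewrite inE.
apply: adj_earlier (maxx y Ky).
by move/forall_inP/(_ x Kx)/forall_inP/(_ y Ky): cK; rewrite eq_sym yx.
Qed.

(* The tree has a node for every vertex, with bag x |: earlier x, and the
   parent of x is the last vertex of earlier x; the root None has the empty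
   bag, so that the tree is not empty even when G is. *)
Definition parent (x : G) : option G :=
  [pick y in earlier x | [forall z in earlier x, r z <= r y]].

Variant parent_spec x : option G -> Prop :=
  | ParentRoot of earlier x = set0 : parent_spec x None
  | ParentSome y of y \in earlier x & {in earlier x, forall z, r z <= r y} :
      parent_spec x (Some y).

Lemma parentP x : parent_spec x (parent x).
Proof.
rewrite /parent; case: pickP => [y /andP[ey /forall_inP maxy] | none].
  by constructor.
constructor; apply/eqP/set0Pn => -[y0 ey0].
case: (arg_maxnP r ey0) => y ey maxy; have := none y.
by move/negbT/negP; case; apply/andP; split=> //; apply/forall_inP.
Qed.

Definition etree_adj : rel (option G) := fun a b =>
  (if a is Some x then parent x == b else false) ||
  (if b is Some y then parent y == a else false).

(** The shift by one puts the root strictly below every vertex. *)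
Definition etree_rank (a : option G) : nat :=
  if a is Some x then (r x).+1 else 0.

Lemma etree_rank_parent x : etree_rank (parent x) < etree_rank (Some x).
Proof. by case: parentP => [_ | y] //=; rewrite inE => /andP[]. Qed.

Lemma etree_adj_sym : symmetric etree_adj.
Proof. by move=> a b; rewrite /etree_adj orbC. Qed.

Lemma etree_adj_irr : irreflexive etree_adj.
Proof.
move=> [x|] //; rewrite /etree_adj orbb; apply/negbTE/eqP => px.
by have := etree_rank_parent x; rewrite px ltnn.
Qed.

Definition etree : sgraph := SGraph etree_adj_sym etree_adj_irr.

Definition etree_bag (a : etree) : {set G} :=
  if a is Some x then x |: earlier x else set0.

Lemma tree_etree : tree etree.
Proof.
have up (a b : etree) : adj a b -> etree_rank b <= etree_rank a ->
    exists2 x, a = Some x & parent x = b.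
  move=> /orP[]; first by case: a => // x /eqP pxb _; exists x.
  by case: b => // y /eqP <-; rewrite leqNgt etree_rank_parent.
apply: (@tree_of_rank etree etree_rank None) => [[x|] // _ | a b c ab ac ba ca].
  by exists (parent x); rewrite ?etree_rank_parent //= /etree_adj eqxx.
have [x ax <-] := up a b ab ba.
by have [y] := up a c ac ca; rewrite ax => -[<-].
Qed.

(** The nodes whose bags contain [v] all lead up to [Some v]: if [v] is in [earlier x] and [y] is
    the last vertex there, then [v] equals [y] or is an earlier neighbour of it, so the bag of the
    parent of [x] contains [v] too. *)
Lemma decomposition_etree : decomposition etree_bag.
Proof.
have bag_adj u v : adj u v -> r v <= r u ->
    (u \in etree_bag (Some u)) && (v \in etree_bag (Some u)).
  by move=> uv le_vu; rewrite setU11 setU1r // adj_earlier.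
split=> [v | u v uv | v].
- by exists (Some v); rewrite setU11.
- case: (leqP (r v) (r u)) => [|/ltnW] le_r.
    by exists (Some u); apply: bag_adj.
  by exists (Some v); rewrite andbC bag_adj // adj_sym.
apply/connected_induced/(@conn_from _ (Some v : etree)) => -[x|]; last first.
  by rewrite !inE.
have [n] := ubnP (r x); elim: n x => // n IHn x lt_x vx.
have [-> // | xv] := eqVneq x v.
have ev : v \in earlier x.
  by move: vx; rewrite inE => /setU1P[vx | //]; rewrite vx eqxx in xv.
have px : adj (parent x : etree) (Some x) by rewrite /= /etree_adj eqxx orbT.
case: parentP px => [x0 | y ey maxy] px; first by rewrite x0 inE in ev.
have vy : Some y \in [set t | v \in etree_bag t].
  rewrite inE /=; have [-> | vy] := eqVneq v y; first exact: setU11.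
  by rewrite setU1r // adj_earlier ?maxy // (earlier_adj ey ev) // eq_sym.
apply: connect_trans (IHn y _ vy) (connect1 _); last by rewrite /adj_in vy vx.
by move: ey; rewrite inE => /andP[_ /leq_trans]; apply.
Qed.

Lemma treewidth_earlier : treewidth_at_most G k.
Proof.
exists etree, etree_bag; split=> [||[x|]]; last by rewrite cards0.
- exact: tree_etree.
- exact: decomposition_etree.
by apply: leq_trans (leq_card_setU _ _) _; rewrite cards1 add1n ltnS.
Qed.

End EliminationOrder.

(** * From bandwidth to pathwidth to treewidth *)

Section Bandwidth.
Variables (G : sgraph) (k : nat).

Lemma tree_path_graph n : tree (path_graph n.+1).
Proof.
apply: (@tree_of_rank (path_graph n.+1) (@nat_of_ord n.+1) ord0)
  => [x x0 | x y z].
  have lt_x : x.-1 < n.+1 by apply: leq_ltn_trans (leq_pred x) (ltn_ord x).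
  have {}x0 : 0 < x by rewrite lt0n; apply: contra x0.
  exists (Ordinal lt_x); rewrite /= ?/path_adj /= ?prednK ?eqxx ?orbT //.
rewrite /= /path_adj => /orP[/eqP <- | /eqP yx]; first by rewrite ltnn.
move=> /orP[/eqP <- | /eqP zx]; first by rewrite ltnn.
by move=> _ _; apply/val_inj/eq_add_S; rewrite /= yx zx.
Qed.

Lemma treewidth_pathwidth : pathwidth_at_most G k -> treewidth_at_most G k.
Proof.
case=> n [B [dB wB]]; exists (path_graph n.+1), B; split=> //.
exact: tree_path_graph.
Qed.

Lemma pathwidth_bandwidth : bandwidth_at_most G k -> pathwidth_at_most G k.
Proof.
case=> f [/bij_inj f_inj bw].
(* The bags are windows of [k.+1] consecutive positions. The extra node keeps the path non-empty
   when [G] is empty. *)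
pose B (i : path_graph #|G|.+1) := [set x | i <= f x <= i + k].
exists #|G|, B; split.
  split=> [x | x y xy | x].
  - by exists (widen_ord (leqnSn _) (f x)); rewrite inE /= leqnn leq_addr.
  - have [lexy leyx] := bw x y xy; case/orP: (leq_total (f x) (f y)) => le_f.
      exists (widen_ord (leqnSn _) (f x)).
      by rewrite !inE /= leqnn leq_addr le_f leyx.
    exists (widen_ord (leqnSn _) (f y)).
    by rewrite !inE /= leqnn leq_addr le_f lexy.
  pose fx : path_graph #|G|.+1 := widen_ord (leqnSn _) (f x).
  apply/connected_induced/(@conn_from _ fx) => i.
  have [n] := ubnP (f x - i); elim: n i => // n IHn i le_n; rewrite !inE.
  case/andP; rewrite leq_eqVlt => /predU1P[ix _ | lt_ix le_xi].
    by rewrite (_ : i = fx) //; apply: val_inj.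
  have lt_i : i.+1 < #|G|.+1 by rewrite ltnS (leq_trans lt_ix) // ltnW.
  have iB : (Ordinal lt_i : path_graph _) \in [set t | x \in B t].
    by rewrite !inE /= lt_ix addSn leqW.
  apply: connect_trans (IHn (Ordinal lt_i) _ iB) (connect1 _).
    by rewrite /= subnS -ltnS prednK ?subn_gt0.
  by rewrite /adj_in iB !inE /= /path_adj /= eqxx orbT (ltnW lt_ix) le_xi.
move=> i; rewrite cardE -(size_map (fun x => f x : nat)) -(size_iota i k.+1).
apply: uniq_leq_size => [|j /mapP[x]].
  by rewrite map_inj_uniq ?enum_uniq // => x y /val_inj/f_inj.
by rewrite mem_enum inE mem_iota addnS ltnS => ix ->.
Qed.

End Bandwidth.

(** * Bandwidth of minimal connected sets, clique minors and transversals *)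

Section Partition.
Variable G : sgraph.
Implicit Types (A B C U : {set G}) (P : seq {set G}).

Lemma bandwidth_order A s k : uniq s -> s =i A ->
  (forall x y, x \in A -> y \in A -> adj x y -> index y s <= index x s + k) ->
  bandwidth_at_most (induced A) k.
Proof.
move=> us sA bw; have sE : size s = #|induced A|.
  by rewrite card_sig -(card_uniqP us); apply: eq_card.
have lt_i (u : induced A) : index (val u) s < #|induced A|.
  by rewrite -sE index_mem sA (valP u).
exists (fun u => Ordinal (lt_i u)); split=> [|u v uv /=].
  apply: inj_card_bij => [u v [iuv]|]; last by rewrite card_ord.
  have su : val u \in s by rewrite sA (valP u).
  apply: val_inj; rewrite -(nth_index (val u) su) iuv nth_index //.
  by rewrite sA (valP v).
have uA := valP u; have vA := valP v.
by split; apply: bw; rewrite // adj_sym.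
Qed.

Lemma bandwidth_minset A U :
  minset (fun B => conn B && (U \subset B)) A -> U != set0 ->
  bandwidth_at_most (induced A) #|U|.-1.
Proof.
move=> minA /set0Pn[x0 Ux0].
have [/andP[cA /subsetP UA] _] := minsetP minA.
have [s [bs sA]] := bfs_exists cA (UA x0 Ux0).
apply: (bandwidth_order _ sA); first by case: bs.
exact: bfs_bandwidth minA Ux0 bs sA.
Qed.

Lemma bandwidth_at_mostS (H : sgraph) k m :
  k <= m -> bandwidth_at_most H k -> bandwidth_at_most H m.
Proof.
move=> le_km [f [f_bij bw]]; exists f; split=> // x y /bw[le1 le2].
by split; apply: leq_trans (leq_add (leqnn _) le_km).
Qed.

Lemma minor_touching P t :
  uniq P -> t <= size P ->
  {in P, forall A, A != set0 /\ conn A} ->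
  {in P &, forall A B, A != B -> [disjoint A & B] /\ touch A B} ->
  minor (complete_graph t) G.
Proof.
move=> uP le_t cP tP; exists (fun i : 'I_t => nth set0 P i).
have lt_i (i : 'I_t) : i < size P by apply: leq_trans (ltn_ord i) le_t.
have mem (i : 'I_t) : nth set0 P i \in P by apply: mem_nth.
have neq (i j : 'I_t) : i != j -> nth set0 P i != nth set0 P j.
  by rewrite nth_uniq.
split=> [i | i j /neq ij | i j /neq ij].
- by have [? /connected_induced] := cP _ (mem i).
- by have [] := tP _ _ (mem i) (mem j) ij.
by have [_ /touchP] := tP _ _ (mem i) (mem j) ij.
Qed.

(** One vertex of [C] is taken for each member of [P]; the same vertex may serve several members. *)
Lemma touch_transversal C P : all (touch C) P ->
  exists U, [/\ U \subset C, #|U| <= size P & {in P, forall A, touch U A}].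
Proof.
elim: P => [_ | A P IHP /andP[/touchP[u [v [Cu Av uv]]] /IHP[U [sUC le_U tU]]]].
  by exists set0; rewrite sub0set cards0.
exists (u |: U); split=> [||B].
- by rewrite subUset sub1set Cu.
- by rewrite cardsU1; case: (u \notin U) => //=; apply: leqW.
rewrite inE => /predU1P[-> | /tU]; last exact/touchS/subsetUr.
by apply/touchP; exists u, v; rewrite setU11.
Qed.

(** * Choosing the parts one after the other *)

Variable t : nat.

Definition clique_nbrs C P := {in P &, forall A B,
  A != B -> touch C A -> touch C B -> touch A B}.

(* P lists the parts from the last one to the first one; t is shifted by 4 with
   respect to the excluded clique minor. *)
Fixpoint good P : Prop :=
  if P is A :: Q then
    [/\ A != set0 /\ conn A, all (fun B : {set G} => [disjoint A & B]) Q,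
        clique_nbrs A Q /\ count (touch A) Q <= t.+2,
        bandwidth_at_most (induced A) t.+1 & good Q]
  else True.

Lemma good_nth P i : good P -> i < size P ->
  let A := nth set0 P i in let Q := drop i.+1 P in
    [/\ A != set0 /\ conn A, all (fun B : {set G} => [disjoint A & B]) Q,
        clique_nbrs A Q /\ count (touch A) Q <= t.+2 &
        bandwidth_at_most (induced A) t.+1].
Proof.
elim: P i => // A P IHP [|i] /= [] *; first by rewrite drop0.
exact: IHP.
Qed.

Lemma good_mem P A : good P -> A \in P -> A != set0 /\ conn A.
Proof.
move=> gP PA; rewrite -(nth_index set0 PA).
by have [] := good_nth gP (_ : index A P < size P); rewrite ?index_mem.
Qed.

Lemma good_uniq P : good P -> uniq P.
Proof.
elim: P => //= A P IHP [[A0 _] /allP dA _ _ /IHP ->]; rewrite andbT.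
by apply/negP => /dA; rewrite -setI_eq0 setIid (negbTE A0).
Qed.

Lemma good_disjoint P : good P ->
  {in P &, forall A B, A != B -> [disjoint A & B]}.
Proof.
elim: P => //= A P IHP [_ /allP dA _ _ /IHP dP] B C.
rewrite !inE => /predU1P[-> | PB] /predU1P[-> | PC]; first by rewrite eqxx.
- by move=> _; apply: dA.
- by move=> _; rewrite disjoint_sym; apply: dA.
exact: dP.
Qed.

(** The invariant that lets the construction continue: it constrains the sets from which later parts
    are chosen. *)
Definition extendable P := forall C : {set G},
  conn C -> {in P, forall A, [disjoint C & A]} -> clique_nbrs C P.

Definition uncovered P := [set x | all (fun A : {set G} => x \notin A) P].

Hypothesis no_minor : ~ minor (complete_graph t.+4) G.

(** If [t.+3] parts touched [C], they would form with [C] the branch sets of a complete minor on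
    [t.+4] vertices. *)
Lemma count_touch C P : good P -> extendable P -> C != set0 -> conn C ->
  {in P, forall A, [disjoint C & A]} -> count (touch C) P <= t.+2.
Proof.
move=> gP eP C0 cC dC; rewrite leqNgt; apply/negP => lt_t; apply: no_minor.
have nPC : C \notin P.
  by apply/negP => /dC; rewrite -setI_eq0 setIid (negbTE C0).
apply: (@minor_touching (C :: filter (touch C) P)).
- by rewrite /= mem_filter (negbTE nPC) andbF filter_uniq ?good_uniq.
- by rewrite /= size_filter.
- move=> A; rewrite inE mem_filter => /predU1P[-> // | /andP[_]].
  exact: good_mem.
move=> A B; rewrite !inE !mem_filter.
case/predU1P=> [-> | /andP[tA PA]] /predU1P[-> | /andP[tB PB]] AB.
- by rewrite eqxx in AB.
- by split; first exact: dC.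
- by rewrite disjoint_sym touch_sym; split; first exact: dC.
by split; [apply: good_disjoint gP _ _ _ _ _ | apply: eP dC _ _ _ _ _ _ _].
Qed.

Lemma good_extend P : good P -> extendable P -> uncovered P != set0 ->
  exists A, [/\ good (A :: P), extendable (A :: P) &
                #|uncovered (A :: P)| < #|uncovered P|].
Proof.
move=> gP eP /set0Pn[x ux].
pose free C := conn C && all (fun A : {set G} => [disjoint C & A]) P.
have fx : free [set x].
  rewrite /free conn1; apply/allP => A PA; rewrite disjoints1.
  by move: ux; rewrite inE => /allP; apply.
(* By maximality [C] is the component of [x] among the uncovered vertices. *)
have [C /maxsetP[/andP[cC dC] maxC] xC] := maxset_exists fx.
have Cx : x \in C by rewrite -sub1set.
have {}dC : {in P, forall A, [disjoint C & A]} by apply/allP.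
have C0 : C != set0 by apply/set0Pn; exists x.
have le_t := count_touch gP eP C0 cC dC.
have [|V [sVC le_V tV]] := @touch_transversal C (filter (touch C) P).
  exact: filter_all.
(* When no part touches [C], the transversal [V] may be empty, and a minimal connected set
   containing it would be empty as well; [x] is used instead. *)
pose U := if V == set0 then [set x] else V.
have U0 : U != set0.
  by rewrite /U; case: ifP => [_ | ->] //; apply/set0Pn; exists x; rewrite inE.
have sUC : U \subset C by rewrite /U; case: ifP => //; rewrite sub1set.
have sVU : V \subset U by rewrite /U; case: ifP => // /eqP ->; apply: sub0set.
have le_U : #|U|.-1 <= t.+1.
  rewrite /U; case: ifP => _; first by rewrite cards1.
  by rewrite -subn1 leq_subLR add1n (leq_trans le_V) // size_filter.
have cU : conn C && (U \subset C) by rewrite cC.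
have [A minA sAC] := minset_exists (P := fun B => conn B && (U \subset B)) cU.
have [/andP[cA sUA] _] := minsetP minA.
have [x0 Ux0] := set0Pn _ U0.
have Ax0 : x0 \in A by apply: (subsetP sUA).
have dA : {in P, forall B, [disjoint A & B]}.
  by move=> B /dC; apply: disjointWl.
(* Shrinking [C] to [A] loses no contact with a part, because [A] contains the transversal. *)
have tA B : B \in P -> touch A B = touch C B.
  move=> PB; apply/idP/idP; first exact: touchS.
  move=> tB; apply: (touchS (subset_trans sVU sUA)); apply: tV.
  by rewrite mem_filter tB.
have A0 : A != set0 by apply/set0Pn; exists x0.
exists A; split.
- split=> //; first exact/allP.
    by split; [apply: eP | rewrite (eq_in_count tA)].
  by apply: bandwidth_at_mostS le_U (bandwidth_minset minA U0).
- move=> D cD dD.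
  have dDP : {in P, forall B, [disjoint D & B]}.
    by move=> B PB; apply: dD; rewrite inE PB orbT.
  (* A connected set [D] of uncovered vertices that touches [A] lies in the component [C], so a part
     touching [D] touches [C] and therefore [A]. *)
  have tD B : B \in P -> touch D A -> touch D B -> touch A B.
    move=> PB tDA tDB; rewrite tA //.
    suff sDC : D \subset C by apply: touchS tDB.
    have fCD : free (C :|: D).
      rewrite /free connU //; last by rewrite (touchS sAC) // touch_sym.
      apply/allP => E PE.
      by rewrite -setI_eq0 setIUl setU_eq0 !setI_eq0 dC ?dDP.
    by rewrite -(maxC _ fCD (subsetUl _ _)) subsetUr.
  move=> B E; rewrite !inE => /predU1P[-> | PB] /predU1P[-> | PE].
  + by rewrite eqxx.
  + by move=> _; apply: tD.
  + by move=> _ tB tDA; rewrite touch_sym; apply: tD.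
  exact: eP.
apply: proper_card; apply/properP; split.
  by apply/subsetP => y; rewrite !inE /= => /andP[].
exists x0; last by rewrite inE /= Ax0.
rewrite inE; apply/allP => B /dA; apply: contraL => Bx0.
by apply/pred0Pn; exists x0; rewrite /= Ax0.
Qed.

Lemma good_cover : exists P, good P /\ uncovered P = set0.
Proof.
have [P [gP eP]] : exists P, [/\ good P, extendable P & #|uncovered P| <= 0].
  have : exists P, [/\ good P, extendable P & #|uncovered P| <= #|G|].
    by exists [::]; split=> //; apply: max_card.
  elim: #|G| => // n IHn [P [gP eP le_n]]; apply: IHn.
  have [u0 | un0] := eqVneq (uncovered P) set0.
    by exists P; rewrite u0 cards0.
  have [A [gA eA lt_A]] := good_extend gP eP un0.
  by exists (A :: P); split=> //; rewrite -ltnS (leq_trans lt_A).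
by rewrite leqn0 cards_eq0 => /eqP; exists P.
Qed.

(** * The elimination ordering of the quotient *)

Section Quotient.
Variable P : seq {set G}.
Hypotheses (gP : good P) (uP : uncovered P = set0).

Let H (i : 'I_(size P)) : {set G} := nth set0 P i.

(** Positions are reversed because [P] starts with the part chosen last; smaller rank means chosen
    earlier. *)
Let rank (i : quotient_graph H) : nat := size P - i.

Lemma good_partition : connected_partition H.
Proof.
split=> [i | i j ij |].
- by have [? /connected_induced] := good_mem gP (mem_nth set0 (ltn_ord i)).
- by apply: (good_disjoint gP); rewrite ?mem_nth ?nth_uniq ?good_uniq.
apply/setP => x; rewrite inE; apply/bigcupP.
have : x \notin uncovered P by rewrite uP inE.
rewrite inE => /allPn[A PA /negPn Ax].
have lt_A : index A P < size P by rewrite index_mem.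
by exists (Ordinal lt_A); rewrite // /H /= nth_index.
Qed.

Lemma rank_inj : injective rank.
Proof.
move=> i j; have := ltn_ord i; have := ltn_ord j; rewrite /rank => *.
by apply: val_inj => /=; lia.
Qed.

Lemma earlierE i j : (j \in earlier rank i) = (i < j) && touch (H i) (H j).
Proof.
rewrite inE /= /quotient_adj /rank ltn_sub2lE; last exact: ltnW.
rewrite -/(touch _ _) andbAC; case: ltnP => [lt_ij | _]; rewrite ?andbF //.
by rewrite -val_eqE neq_ltn lt_ij.
Qed.

Lemma mem_H_drop (i j : 'I_(size P)) : i < j -> H j \in drop i.+1 P.
Proof.
move=> lt_ij; rewrite /H -(subnKC lt_ij) -nth_drop mem_nth //.
by rewrite size_drop ltn_sub2r // (leq_ltn_trans lt_ij).
Qed.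

Lemma H_inj : injective H.
Proof.
by move=> i j /eqP; rewrite nth_uniq ?good_uniq // => /eqP/val_inj.
Qed.

Lemma clique_earlier_good i : clique (earlier rank i).
Proof.
have [_ _ [cl _] _] := good_nth gP (ltn_ord i).
apply/forall_inP => j; rewrite earlierE => /andP[ij tj].
apply/forall_inP => k; rewrite earlierE => /andP[ik tk].
apply/implyP => jk; rewrite /= /quotient_adj jk -/(touch _ _).
by apply: cl; rewrite ?mem_H_drop // (inj_eq H_inj).
Qed.

Lemma card_earlier_good i : #|earlier rank i| <= t.+2.
Proof.
have [_ _ [_ le_t] _] := good_nth gP (ltn_ord i); apply: leq_trans le_t.
rewrite cardE -(size_map H) -size_filter; apply: uniq_leq_size.
  by rewrite (map_inj_uniq H_inj) enum_uniq.
move=> A /mapP[j]; rewrite mem_enum earlierE => /andP[ij tj] ->.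
by rewrite mem_filter tj mem_H_drop.
Qed.

End Quotient.
End Partition.

Theorem theorem4 (t : nat) (ht : 4 <= t) (G : sgraph)
    (hG : ~ minor (complete_graph t) G) :
  exists (l : nat) (H : 'I_l -> {set G}),
    [/\ connected_partition H,
        [/\ chordal (quotient_graph H),
            clique_number (quotient_graph H) <= t - 1 &
            treewidth_at_most (quotient_graph H) (t - 2)] &
        forall i : 'I_l,
          [/\ bandwidth_at_most (induced (H i)) (t - 3),
              pathwidth_at_most (induced (H i)) (t - 3) &
              treewidth_at_most (induced (H i)) (t - 3)]].
Proof.
(* From here on the excluded clique has [t.+4] vertices, so the three bounds become [t.+3], [t.+2]
   and [t.+1]. *)
case: t ht hG => [|[|[|[|t]]]] // _ hG.
have [P [gP uP]] := good_cover hG.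
have cl := clique_earlier_good gP; have le_k := card_earlier_good gP.
have inj := @rank_inj G P.
exists (size P), (fun i => nth set0 P i); split.
- exact: good_partition gP uP.
- split; rewrite ?subSS ?subn0.
  + exact: chordal_earlier inj cl.
  + exact: clique_number_earlier inj le_k.
  exact: treewidth_earlier inj cl le_k.
move=> i; have [_ _ _ bw] := good_nth gP (ltn_ord i).
rewrite !subSS subn0; have pw := pathwidth_bandwidth bw.
by split=> //; apply: treewidth_pathwidth.
Qed.
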